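(* Let $\mathcal{F}=\langle W,R,\{S_x\}_{x\in W}\rangle$ be a Veltman frame, let $f$ be an ultrafilter on $W$, and let $l\subseteq\wp(W)\setminus\{\emptyset\}$ have the finite intersection property. Suppose that for every finite $l'\subseteq l$ there exists an ultrafilter $g$ on $W$ with $f\prec_{l'}g$. Then there exists an ultrafilter $h$ on $W$ with $f\prec_l h$.
   Context: A Veltman frame is $\langle W,R,\{S_w\}\rangle$ where: - $W$ is nonempty. - $R$ is transitive and conversely well-founded. - Each $S_w$ is a reflexive transitive relation on $R[w]=\{v:wRv\}$ containing $R\cap R[w]^2$. For $X,Y\subseteq W$: - $\overline{Y}=W\setminus Y$. - $\widehat{R^{-1}}(Y)=\{x:\forall y(xRy\to y\in Y)\}$. - $S^{-1}(X,Y)=\{w:\forall x\in X(wRx\to\exists y\in Y\,xS_wy)\}$. For a family $l\subseteq\wp(W)$ and ultrafilters $f,g$ on $W$, $f\prec_l g$ means the following: for every $A\subseteq W$ and every finite (possibly empty) family $S_1,\dots,S_n\in l$, if $S^{-1}(\overline{A},\overline{S_1}\cup\dots\cup\overline{S_n})\in f$ then $A\in g$ and $\widehat{R^{-1}}(A)\in g$. *)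

(* Defs.v *)
From mathcomp Require Import all_boot all_classical.

Set Implicit Arguments.
Unset Strict Implicit.
Unset Printing Implicit Defensive.

Local Open Scope classical_set_scope.

(* [vS w x y] is x S_w y. *)
Record veltmanFrame := VeltmanFrame {
  world :> Type ;
  vR : world -> world -> Prop ;
  vS : world -> world -> world -> Prop ;
  world_nonempty : inhabited world ;
  vR_trans : forall x y z, vR x y -> vR y z -> vR x z ;
  vR_cwf : well_founded (fun x y => vR y x) ;
  vS_dom : forall w x y, vS w x y -> vR w x /\ vR w y ;
  vS_refl : forall w x, vR w x -> vS w x x ;
  vS_trans : forall w x y z, vS w x y -> vS w y z -> vS w x z ;
  vS_vR : forall w x y, vR w x -> vR w y -> vR x y -> vS w x y
}.

Section Operators.
Variable F : veltmanFrame.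

Definition boxR (Y : set F) : set F := [set x | forall y, vR x y -> Y y].

Definition invS (X Y : set F) : set F :=
  [set w | forall x, X x -> vR w x -> exists2 y, Y y & vS w x y].

Definition prec (l : set_system F) (f g : set_system F) : Prop :=
  forall (A : set F) (n : nat) (S : 'I_n -> set F),
    (forall i, l (S i)) ->
    f (invS (~` A) (\bigcup_i ~` S i)) -> g A /\ g (boxR A).

End Operators.

(* Main.v *)
Require Import Defs.
From mathcomp Require Import all_boot all_classical.

Local Open Scope classical_set_scope.

(** Compactness. The sets that belong to every ultrafilter [g] with
    [prec l' f g], for some finite [l'] contained in [l], form a filter:
    two witnesses [l'] merge into their union because [prec] is antitone in the
    family, and properness is the hypothesis on finite subfamilies. Any
    ultrafilter extending it works, since each instance of [prec l] mentions
    only finitely many members of [l]. *)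

Lemma prec_antitone (F : veltmanFrame) (l l' f g : set_system F) :
  l `<=` l' -> prec l' f g -> prec l f g.
Proof. by move=> ll' fg A n S lS; apply: fg => i; exact/ll'. Qed.

Definition finprec_core (F : veltmanFrame) (l f : set_system F) : set_system F :=
  [set B | exists l' : set_system F, [/\ finite_set l', l' `<=` l &
    forall g, UltraFilter g -> prec l' f g -> g B]].

Lemma finprec_core_filter (F : veltmanFrame) (l f : set_system F) :
  (forall l' : set_system F, finite_set l' -> l' `<=` l ->
     exists g : set_system F, UltraFilter g /\ prec l' f g) ->
  ProperFilter (finprec_core F l f).
Proof.
move=> l_fin; split.
  (* Were [set0] in the core with witness [l'], the ultrafilter that [l_fin] supplies for [l'] would
     contain [set0]. *)
  move=> [l' [l'_fin l'l core0]].
  have [g [g_ultra fg]] := l_fin l' l'_fin l'l.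
  exact: filter_not_empty (core0 g g_ultra fg).
split.
- by exists set0; split=> // g g_ultra _; exact: filterT.
- move=> P Q [l1 [l1_fin l1l coreP]] [l2 [l2_fin l2l coreQ]].
  exists (l1 `|` l2); split; first by rewrite finite_setU.
    by rewrite subUset.
  move=> g g_ultra fg; apply: filterI.
    by apply: coreP => //; apply: prec_antitone fg; exact: subsetUl.
  by apply: coreQ => //; apply: prec_antitone fg; exact: subsetUr.
- move=> P Q PQ [l' [l'_fin l'l coreP]]; exists l'; split=> // g g_ultra fg.
  by apply: filterS PQ _; exact: coreP.
Qed.

Theorem theorem6p7 (F : veltmanFrame) (f : set_system F)
    (f_ultra : UltraFilter f)
    (l : set_system F) (l_nonempty : l `<=` [set~ set0])
    (l_fip : finI l id)
    (l_fin : forall l' : set_system F, finite_set l' -> l' `<=` l ->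
       exists g : set_system F, UltraFilter g /\ prec l' f g) :
  exists h : set_system F, UltraFilter h /\ prec l f h.
Proof.
have [h [h_ultra core_h]] := ultraFilterLemma (finprec_core_filter F l f l_fin).
exists h; split=> // A n S lS fA.
(* The finite witness is [range S], the members of [l] used by this instance; it is empty when [n]
   is 0. *)
have S_fin : finite_set (range S) by exact/finite_image/finite_finset.
have Sl : range S `<=` l by move=> _ [i _ <-].
have rangeS i : range S (S i) by exists i.
(* Every ultrafilter [g] with [prec (range S) f g] satisfies this same instance, so [A] and [boxR A]
   both lie in the core, hence in [h]. *)
by split; apply: core_h; exists (range S); split=> // g _ fg;
  have [] := fg A n S rangeS fA.
Qed.
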